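(* In the worst case, $n$ optimal solutions of $(D)$ are needed to obtain all exact reduced costs of a weighted constraint with $n$ variables: for every integer $n\ge 1$ there exist a constraint $C$ on $n$ variables, costs $c$, and an ideal formulation $(A,b)$, with every pair of $B$ belonging to a support of $C$, such that every complete family of optimal solutions of $(D)$ contains at least $n$ solutions.
   Context: Setting. $n$ variables $X_i$ have finite domains $D(X_i)\subset\mathbb{Z}$, and $C$ is a constraint on them, i.e. a set of allowed tuples. A support for $C$ is an allowed tuple $(a_i)_i$ with $a_i\in D(X_i)$ for all $i$. $B=\{ij : j\in D(X_i)\}$ is the (finite) set of variable/value pairs, where $ij$ is short for $(i,j)$. The characteristic vector of a support is $x\in\{0,1\}^{B}$ with $x_{ij}=1$ iff $a_i=j$; $\mathcal{S}$ is the set of characteristic vectors of the supports of $C$. Each pair has a cost $c_{ij}\in\mathbb{Z}$. An ideal formulation is a pair $(A,b)$ where $A$ is a real $m\times|B|$ matrix (with columns $A_{ij}$, $ij\in B$) and $b\in\mathbb{R}^m$, such that $\{x\in\mathbb{R}^{B}_+ : Ax\ge b\}=\mathrm{conv}(\mathcal{S})$ (equality constraints may be written as pairs of inequalities). $(P)$: $z^*=\min\{cx : Ax\ge b,\ x\in\mathbb{R}^B_+\}$; $(D)$: $\max\{ub : uA\le c,\ u\in\mathbb{R}^m_+\}$. For $kl\in B$, $(P_{|kl})$ is $(P)$ with the additional constraint $x_{kl}=1$, with optimal value $z^*_{|kl}$. For feasible $u$ of $(D)$ the reduced cost of $kl$ is $r_{kl}(u)=c_{kl}-uA_{kl}$.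 $R_{kl}=z^*_{|kl}-z^*$; the reduced cost is exact when $r_{kl}(u)=R_{kl}$. A family $\{u^t\}_{t\in\mathcal{T}}$ of optimal solutions of $(D)$ is complete if for every $kl\in B$ there is $t\in\mathcal{T}$ with $r_{kl}(u^t)=R_{kl}$. *)

(* Defs.v *)
From HB Require Import structures.
From mathcomp Require Import all_boot all_order all_algebra.
From mathcomp Require Import finmap.
From mathcomp Require Import all_classical all_reals.
From mathcomp Require Import convex.

Set Implicit Arguments.
Unset Strict Implicit.
Unset Printing Implicit Defensive.

Import Order.TTheory GRing.Theory Num.Theory.

Local Open Scope classical_set_scope.
Local Open Scope ring_scope.

(* The set B: the pair ij is (existT _ i j), with i = tag ij and
   j = val (tagged ij). Vectors of R^B are matrices indexed by 'I_#|B|, the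
   coordinate of ij being enum_rank ij. *)
Definition pairs (n : nat) (D : 'I_n -> {fset int}) : finType :=
  {i : 'I_n & D i}.

Definition var (n : nat) (D : 'I_n -> {fset int}) (ij : pairs D) : 'I_n :=
  tag ij.

Definition value (n : nat) (D : 'I_n -> {fset int}) (ij : pairs D) : int :=
  val (tagged ij).

Definition supports (n : nat) (D : 'I_n -> {fset int})
    (C : set (n.-tuple int)) : set (n.-tuple int) :=
  [set a | C a /\ forall i, tnth a i \in D i].

Definition charvec (R : realType) (n : nat) (D : 'I_n -> {fset int})
    (a : n.-tuple int) : 'cV[R]_#|pairs D| :=
  \col_k (tnth a (var (enum_val k)) == value (enum_val k))%:R.

Definition conv_hull (R : realType) (N : nat) (S : set 'cV[R]_N) :
    set 'cV[R]_N :=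
  smallest (@convex_set R 'cV[R]_N) S.

(* Entrywise order. *)
Definition lemx (R : realType) (p q : nat) (M M' : 'M[R]_(p, q)) : Prop :=
  forall i j, M i j <= M' i j.

(* The minimum of E; it is 0 when E has no least element. *)
Definition minimum (R : realType) (E : set R) : R :=
  xget 0 [set z | E z /\ lbound E z].

Section LinearProgram.
Variables (R : realType) (m N : nat).
Implicit Types (A : 'M[R]_(m, N)) (b : 'cV[R]_m) (c : 'rV[R]_N).

Definition primal_feasible A b : set 'cV[R]_N :=
  [set x | lemx b (A *m x) /\ lemx 0 x].

Definition primal_value A b c : R :=
  minimum [set (c *m x) 0 0 | x in primal_feasible A b].

Definition primal_value_at A b c (k : 'I_N) : R :=
  minimum [set (c *m x) 0 0 | x in
    primal_feasible A b `&` [set x : 'cV[R]_N | x k 0 = 1]].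

Definition dual_feasible A c : set 'rV[R]_m :=
  [set u | lemx (u *m A) c /\ lemx 0 u].

Definition dual_optimal A b c : set 'rV[R]_m :=
  [set u | dual_feasible A c u /\
    forall v, dual_feasible A c v -> (v *m b) 0 0 <= (u *m b) 0 0].

Definition reduced_cost A c (u : 'rV[R]_m) (k : 'I_N) : R :=
  c 0 k - (u *m col k A) 0 0.

Definition exact_at A b c (u : 'rV[R]_m) (k : 'I_N) : Prop :=
  reduced_cost A c u k = primal_value_at A b c k - primal_value A b c.

End LinearProgram.

Definition ideal_formulation (R : realType) (n : nat)
    (D : 'I_n -> {fset int}) (C : set (n.-tuple int)) (m : nat)
    (A : 'M[R]_(m, #|pairs D|)) (b : 'cV[R]_m) : Prop :=
  primal_feasible A b = conv_hull (@charvec R n D @` supports D C).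

Definition complete (R : realType) (n : nat) (D : 'I_n -> {fset int}) (m : nat)
    (A : 'M[R]_(m, #|pairs D|)) (b : 'cV[R]_m) (c : 'rV[R]_#|pairs D|)
    (T : Type) (u : T -> 'rV[R]_m) : Prop :=
  forall kl : pairs D, exists t : T, exact_at A b c (u t) (enum_rank kl).

(* Main.v *)
Require Import Defs.
From HB Require Import structures.
From mathcomp Require Import all_boot all_order all_algebra.
From mathcomp Require Import finmap.
From mathcomp Require Import all_classical all_reals.
From mathcomp Require Import interval_inference convex lra.

Set Implicit Arguments.
Unset Strict Implicit.
Unset Printing Implicit Defensive.

Import Order.TTheory GRing.Theory Num.Theory.

Local Open Scope classical_set_scope.
Local Open Scope ring_scope.

(** The reduced costs of an optimal dual solution are nonnegative and, by
    complementary slackness, their sum over the pairs of a support [a] is at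
    most [c a - z*].  Take the all-equal constraint on {0,1}^n with costs
    [c_ij = j]: the support (1,...,1) is the only one containing any pair [i1],
    so the [n] exact reduced costs [R_i1] all equal its excess cost [n > 0],
    and no dual solution can reach two of them. *)

Lemma minimumE (R : realType) (E : set R) (z : R) :
  E z -> lbound E z -> minimum E = z.
Proof.
move=> Ez lz; apply: xget_unique => // y [Ey ly].
by apply/le_anti; rewrite ly//= lz.
Qed.

(** * Weak duality for reduced costs, and convexity of the primal polyhedron *)

Section Duality.
Variables (R : realType) (m N : nat).
Variables (A : 'M[R]_(m, N)) (b : 'cV[R]_m) (c : 'rV[R]_N).

Lemma reduced_costE (u : 'rV[R]_m) k : reduced_cost A c u k = (c - u *m A) 0 k.
Proof.
rewrite /reduced_cost !mxE; congr (_ - _); apply: eq_bigr => i _.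
by rewrite !mxE.
Qed.

Lemma reduced_cost_ge0 (u : 'rV[R]_m) k :
  dual_feasible A c u -> 0 <= reduced_cost A c u k.
Proof. by move=> [uA _]; rewrite reduced_costE mxE mxE subr_ge0. Qed.

(** The left side is [(c - u A) x = c x - u (A x)], and [u (A x) >= u b] because [u >= 0] and
    [A x >= b]. *)
Lemma sum_reduced_cost_le (u : 'rV[R]_m) (x : 'cV[R]_N) :
  dual_feasible A c u -> primal_feasible A b x ->
  \sum_k reduced_cost A c u k * x k 0 <= (c *m x) 0 0 - (u *m b) 0 0.
Proof.
move=> [uA u0] [Ax x0].
have -> : \sum_k reduced_cost A c u k * x k 0 = ((c - u *m A) *m x) 0 0.
  by rewrite mxE; apply: eq_bigr => k _; rewrite reduced_costE.
rewrite mulmxBl -mulmxA [leLHS]mxE [X in _ + X]mxE lerD2l lerN2.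
rewrite [leLHS]mxE [leRHS]mxE; apply: ler_sum => i _.
by apply: ler_wpM2l => //; have := u0 0 i; rewrite mxE.
Qed.

(** All terms of the previous sum are nonnegative, so all but those of [k] and [l] may be
    dropped. *)
Lemma reduced_cost_pair_le (u : 'rV[R]_m) (x : 'cV[R]_N) k l :
  dual_feasible A c u -> primal_feasible A b x ->
  k != l -> x k 0 = 1 -> x l 0 = 1 ->
  reduced_cost A c u k + reduced_cost A c u l <= (c *m x) 0 0 - (u *m b) 0 0.
Proof.
move=> fu fx kl xk xl; apply: le_trans (sum_reduced_cost_le fu fx).
rewrite (bigD1 k)//= (bigD1 l) 1?eq_sym//= xk xl !mulr1 [leRHS]addrA lerDl.
apply: sumr_ge0 => j _; apply: mulr_ge0; first exact: reduced_cost_ge0.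
by have := fx.2 j 0; rewrite mxE.
Qed.

Lemma primal_feasible_segment (x y : 'cV[R]_N) (t : R) : 0 <= t <= 1 ->
  primal_feasible A b x -> primal_feasible A b y ->
  primal_feasible A b (t *: x + (1 - t) *: y).
Proof.
move=> /andP[t0 t1] [Ax x0] [Ay y0]; split=> i j.
  rewrite mulmxDr -!scalemxAr [leRHS]mxE [X in X + _]mxE [X in _ + X]mxE.
  have := Ax i j; have := Ay i j; nra.
rewrite !mxE; have := x0 i j; have := y0 i j; rewrite !mxE.
by move=> ? ?; apply: addr_ge0; apply: mulr_ge0 => //; rewrite subr_ge0.
Qed.

Lemma convex_primal_feasible :
  @convex_set R 'cV[R]_N (primal_feasible A b).
Proof.
move=> x y t; rewrite !inE => fx fy.
by apply: primal_feasible_segment => //; rewrite ge0 le1.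
Qed.

End Duality.

Lemma conv_hull_segment (R : realType) (N : nat) (S : set 'cV[R]_N)
    (x y : 'cV[R]_N) (t : R) : 0 <= t <= 1 ->
  S x -> S y -> conv_hull S (t *: x + (1 - t) *: y).
Proof.
move=> t01 Sx Sy K [cK SK].
have := cK x y (Itv01 (andP t01).1 (andP t01).2).
by rewrite !inE; apply; exact: SK.
Qed.

(** * The all-equal constraint on {0,1}^n and its ideal formulation *)

Section AllEqual.
Variables (R : realType) (n : nat).

Definition bool_dom (i : 'I_n) : {fset int} := [fset 0; 1]%fset.

Definition all_equal : set (n.-tuple int) :=
  [set a | exists j, a = nseq_tuple n j].

Notation B := (pairs bool_dom).
Notation chi j := (charvec R bool_dom (nseq_tuple n j)).

Definition value_cost : 'rV[int]_#|B| := \row_k value (enum_val k).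

Notation cost := (map_mx intr value_cost : 'rV[R]_#|B|).

Definition bool_pair (i : 'I_n) (j : int) (hj : j \in bool_dom i) : B :=
  existT _ i [` hj]%fset.

Definition pair1 (i : 'I_n) : B := @bool_pair i 1 (fset22 0 1).

Lemma value_pair1 i : value (pair1 i) = 1.
Proof. by []. Qed.

Lemma pair1_inj : injective pair1.
Proof. by move=> i j /(congr1 (@var _ _)). Qed.

Lemma valueP (p : B) : value p = 0 \/ value p = 1.
Proof.
have := valP (tagged p); rewrite !inE.
by case/orP=> /eqP; [left|right].
Qed.

(* [x_p] if [p = i1] and [1 - x_p] if [p = i0]: in an integral point, the truth
   value of [X_i = 1] read off the pair [p]. *)
Definition level (x : 'cV[R]_#|B|) (p : B) : R :=
  (-1) ^+ (value p == 0) * x (enum_rank p) 0 + (value p == 0)%:R.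

(* The row indexed by [(p, q)] says [level x q <= level x p]. *)
Definition level_mx : 'M[R]_(#|{: B * B}|, #|B|) :=
  \matrix_(r, k)
    let: (p, q) := enum_val r in
    (-1) ^+ (value p == 0) * (k == enum_rank p)%:R
    - (-1) ^+ (value q == 0) * (k == enum_rank q)%:R.

(** [level] is affine in [x]; its constant terms are moved here to the right-hand side. *)
Definition level_rhs : 'cV[R]_(#|{: B * B}|) :=
  \col_r let: (p, q) := enum_val r in
    (value q == 0)%:R - (value p == 0)%:R.

Lemma level_mxE x (r : 'I_#|{: B * B}|) : (level_mx *m x) r 0 - level_rhs r 0 =
  level x (enum_val r).1 - level x (enum_val r).2.
Proof.
rewrite !mxE; under eq_bigr do rewrite mxE.
case: (enum_val r) => p q /=.
under eq_bigr do rewrite mulrBl -!mulrA.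
rewrite sumrB -!mulr_sumr /level.
have pick z : \sum_k (k == enum_rank z)%:R * x k 0 = x (enum_rank z) 0.
  rewrite (bigD1 (enum_rank z))//= eqxx mul1r big1 ?addr0// => k /negPf->.
  by rewrite mul0r.
by rewrite !pick opprB addrACA opprD.
Qed.

(** Rows range over ordered pairs, so [(p, q)] and [(q, p)] together give an equality. *)
Lemma level_feasibleP x : primal_feasible level_mx level_rhs x <->
  (forall p q, level x p = level x q) /\ lemx 0 x.
Proof.
have le_level (r : 'I_#|{: B * B}|) : (level_rhs r 0 <= (level_mx *m x) r 0) =
    (level x (enum_val r).2 <= level x (enum_val r).1).
  by rewrite -subr_ge0 -[RHS]subr_ge0 -level_mxE.
split=> [[Ax x0]|[xl x0]]; split=> //.
  have le p q : level x q <= level x p.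
    by have := Ax (enum_rank (p, q)) 0; rewrite le_level enum_rankK.
  by move=> p q; apply/le_anti; rewrite !le.
by move=> r j; rewrite (ord1 j) le_level (xl _ (enum_val r).2).
Qed.

Lemma chiE j (p : B) : chi j (enum_rank p) 0 = (j == value p)%:R.
Proof. by rewrite mxE enum_rankK tnth_nseq. Qed.

Lemma level_chi j (p : B) : j = 0 \/ j = 1 -> level (chi j) p = j%:~R.
Proof.
rewrite /level chiE => -[]->; case: (valueP p) => -> /=.
all: by rewrite ?expr1 ?expr0; lra.
Qed.

Lemma chi_feasible j : j = 0 \/ j = 1 ->
  primal_feasible level_mx level_rhs (chi j).
Proof.
move=> hj; apply/level_feasibleP; split=> [p q|k l]; first by rewrite !level_chi.
by rewrite !mxE ler0n.
Qed.

Lemma supports_all_equal (a : n.-tuple int) : (0 < n)%N ->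
  supports bool_dom all_equal a ->
  exists2 j, j = 0 \/ j = 1 & a = nseq_tuple n j.
Proof.
move=> n0 [[j ->] aD]; exists j => //.
by have := aD (Ordinal n0); rewrite tnth_nseq !inE => /orP[]/eqP; tauto.
Qed.

Lemma nseq_support j : j = 0 \/ j = 1 ->
  supports bool_dom all_equal (nseq_tuple n j).
Proof.
move=> hj; split; first by exists j.
by move=> i; rewrite tnth_nseq !inE; case: hj => ->; rewrite eqxx ?orbT.
Qed.

(** The common level [s] determines [x]: its coordinates are [s] on pairs of value 1 and [1 - s] on
    pairs of value 0. The index [i] only chooses where [s] is read. *)
Lemma level_feasible_segment x i : primal_feasible level_mx level_rhs x ->
  x = level x (pair1 i) *: chi 1 + (1 - level x (pair1 i)) *: chi 0.
Proof.
move=> /level_feasibleP[xl _]; apply/colP => k.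
rewrite -(enum_valK k); set p := enum_val k.
rewrite [RHS]mxE [X in X + _]mxE [X in _ + X]mxE !chiE (xl _ p) /level.
by case: (valueP p) => -> /=; rewrite ?expr1 ?expr0; lra.
Qed.

(** Both bounds are nonnegativity constraints: for the variable [i] of [p], the level equals [x_i1]
    and also [1 - x_i0]. *)
Lemma level_feasible_itv x p : primal_feasible level_mx level_rhs x ->
  0 <= level x p <= 1.
Proof.
move=> /level_feasibleP[xl x0].
have x_ge0 q : 0 <= x (enum_rank q) 0 by have := x0 (enum_rank q) 0; rewrite mxE.
pose p0 := @bool_pair (var p) 0 (fset21 0 1).
have := x_ge0 (pair1 (var p)); have := x_ge0 p0.
have := xl p p0; have := xl p (pair1 (var p)).
by rewrite /level !value_pair1 /p0 /= expr1 expr0 => -> ?; lra.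
Qed.

(** Both sets are the segment joining [chi 0] and [chi 1], the characteristic vectors of the two
    supports. *)
Lemma all_equal_ideal : (0 < n)%N ->
  ideal_formulation all_equal level_mx level_rhs.
Proof.
move=> n0; apply/seteqP; split=> [x fx|].
  rewrite (level_feasible_segment (Ordinal n0) fx).
  apply: conv_hull_segment; first exact: level_feasible_itv.
    by exists (nseq_tuple n 1) => //; apply: nseq_support; right.
  by exists (nseq_tuple n 0) => //; apply: nseq_support; left.
apply: smallest_sub; first exact: convex_primal_feasible.
by move=> _ [a /(supports_all_equal n0)[j hj ->] <-]; exact: chi_feasible.
Qed.

(** * Optimal values of the primal program and of its restrictions *)

Lemma cost_ge0 k : 0 <= cost 0 k.
Proof. by rewrite !mxE ler0z; case: (valueP (enum_val k)) => ->. Qed.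

Lemma cost_chi0 : (cost *m chi 0) 0 0 = 0.
Proof.
rewrite mxE big1// => k _; rewrite -(enum_valK k) chiE !mxE enum_rankK.
by case: (valueP (enum_val k)) => ->; rewrite ?mulr0 ?mul0r.
Qed.

Lemma cost_chi1_gt0 : (0 < n)%N -> 0 < (cost *m chi 1) 0 0.
Proof.
move=> n0; pose p := pair1 (Ordinal n0).
rewrite mxE (bigD1 (enum_rank p))//= chiE value_pair1 eqxx mulr1.
rewrite !mxE enum_rankK value_pair1 ltr_pwDl// sumr_ge0// => k _.
by rewrite mulr_ge0 ?cost_ge0// mxE ler0n.
Qed.

Lemma all_equal_primal_value : primal_value level_mx level_rhs cost = 0.
Proof.
apply: minimumE.
  by exists (chi 0); [apply: chi_feasible; left|exact: cost_chi0].
move=> _ [x [_ x0] <-]; rewrite mxE sumr_ge0// => k _.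
by rewrite mulr_ge0 ?cost_ge0//; have := x0 k 0; rewrite mxE.
Qed.

Lemma all_equal_primal_value_at i :
  primal_value_at level_mx level_rhs cost (enum_rank (pair1 i)) =
  (cost *m chi 1) 0 0.
Proof.
apply: minimumE.
  exists (chi 1) => //; split; first by apply: chi_feasible; right.
  by rewrite /= chiE value_pair1 eqxx.
(* Fixing [x_i1 = 1] makes the level 1, which leaves [chi 1] as the only feasible point. *)
move=> _ [x [fx x1] <-]; rewrite (level_feasible_segment i fx).
have -> : level x (pair1 i) = 1 by rewrite /level x1 value_pair1 /= expr0; lra.
by rewrite subrr scale0r addr0 scale1r.
Qed.

(** * Dual solutions and the number of exact reduced costs they reach *)

Lemma dual_optimal_value_ge0 (u : 'rV[R]_#|{: B * B}|) :
  dual_optimal level_mx level_rhs cost u -> 0 <= (u *m level_rhs) 0 0.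
Proof.
(* Compare with the dual solution 0, which is feasible since the costs are nonnegative. *)
move=> [_ /(_ 0)]; rewrite mul0mx [leLHS]mxE; apply; split=> i j; last by [].
by rewrite mul0mx (ord1 i) [leLHS]mxE cost_ge0.
Qed.

Lemma exact_pair1_unique (u : 'rV[R]_#|{: B * B}|) i j :
  dual_optimal level_mx level_rhs cost u ->
  exact_at level_mx level_rhs cost u (enum_rank (pair1 i)) ->
  exact_at level_mx level_rhs cost u (enum_rank (pair1 j)) -> i = j.
Proof.
rewrite /exact_at !all_equal_primal_value_at all_equal_primal_value !subr0.
move=> ou ei ej; apply/eqP; apply: contraT => ij.
have : reduced_cost level_mx cost u (enum_rank (pair1 i)) +
       reduced_cost level_mx cost u (enum_rank (pair1 j)) <=
       (cost *m chi 1) 0 0 - (u *m level_rhs) 0 0.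
  apply: reduced_cost_pair_le; first exact: ou.1.
  - by apply: chi_feasible; right.
  - by apply: contraNneq ij => /enum_rank_inj/pair1_inj->.
  - by rewrite chiE.
  - by rewrite chiE.
(* With [K] the cost of [chi 1], the bound reads [2K <= K - u b], against [u b >= 0] and [K > 0]. *)
rewrite ei ej; have := dual_optimal_value_ge0 ou.
have := cost_chi1_gt0 (leq_ltn_trans (leq0n i) (ltn_ord i)); lra.
Qed.

End AllEqual.

Theorem mainTheorem9 (R : realType) (n : nat) (hn : (1 <= n)%N) :
  exists (D : 'I_n -> {fset int}) (C : set (n.-tuple int))
         (c : 'rV[int]_#|pairs D|)
         (m : nat) (A : 'M[R]_(m, #|pairs D|)) (b : 'cV[R]_m),
    [/\ ideal_formulation C A b,
        forall kl : pairs D,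
          exists2 a, supports D C a & tnth a (var kl) = value kl
      & forall (T : Type) (u : T -> 'rV[R]_m),
          (forall t, dual_optimal A b (map_mx intr c) (u t)) ->
          complete A b (map_mx intr c) u ->
          (`I_n #<= range u)%card].
Proof.
exists (@bool_dom n), (@all_equal n), (value_cost n), _, (level_mx R n),
  (level_rhs R n); split.
- exact: all_equal_ideal.
- move=> kl; exists (nseq_tuple n (value kl)); last by rewrite tnth_nseq.
  exact/nseq_support/valueP.
move=> T u ou cu.
(* For each variable [i], choose a member of the family that is exact at [i1]. *)
have [t ext] := choice (fun i => cu (pair1 i)).
(* [I_n] is a set of naturals, so [insubd] turns them into ordinals; its default is never reached
   below [n]. A coincidence of two chosen solutions would be exact at two pairs [i1]. *)
have finj : {in `I_n &, injective (u \o t \o insubd (Ordinal hn))}.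
  move=> k l; rewrite !inE => kn ln /= euv.
  have := exact_pair1_unique (ou _) (ext (insubd (Ordinal hn) k)).
  rewrite euv => /(_ _ (ext _))/(congr1 val).
  by rewrite !val_insubd kn ln.
(* By injectivity the image of [I_n] has its cardinality, and this image lies in [range u]. *)
rewrite -(card_le_eql (inj_card_eq finj)); apply: subset_card_le.
by move=> _ [k _ <-]; exists (t (insubd (Ordinal hn) k)).
Qed.
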